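(* The images $\mathcal{Y}$ and $\mathcal{Y}'$ of the (localised) Yang-Baxter algebras in $\mathrm{End}_R(U)$ are both equal to the subalgebra $\mathcal{A}\subset\mathrm{End}_R(U)$ generated over $R$ by the fermionic operators $\gamma_j$ and $\gamma_j^*$, $j=1,\ldots,n$. Hence $\mathcal{Y}=\mathcal{Y}'$.
   Context: Fix $n\ge2$ and let $R=\mathbb{Z}[y_1,\ldots,y_n][q^{\pm1}]$. Let $\varepsilon_0,\varepsilon_1$ be the standard basis of a rank two free module, with matrix units $E_{11},E_{12},E_{21},E_{22}$ ($E_{11}$ projecting onto $\varepsilon_0$, $E_{22}$ onto $\varepsilon_1$, $E_{21}\varepsilon_0=\varepsilon_1$, $E_{12}\varepsilon_1=\varepsilon_0$). $U$ is the free $R$-module with basis $\varepsilon_{\alpha_1}\otimes\cdots\otimes\varepsilon_{\alpha_n}$, $\alpha_i\in\{0,1\}$, and $U_{k,n}\subset U$ is the span of the basis vectors with exactly $k$ factors $\varepsilon_1$. Yang-Baxter algebra action: let $$L(x,y)=\begin{pmatrix} E_{11}+(x+y)E_{22} & E_{21} \\ E_{12} & E_{22} \end{pmatrix}$$ be the $2\times2$ matrix whose entries are operators on the rank two module, let $L_{0i}(x,y_i)$ be $L(x,y_i)$ with entries acting on the $i$-th tensor factor of $U$, and define the monodromy matrix by the matrix product $T(x)=(T_{ab}(x))_{1\le a,b\le2}=L_{0n}(x,y_n)\cdots L_{01}(x,y_1)$, so $T_{ab}(x)\in\mathrm{End}_R(U)[x]$. $\mathcal{Y}\subset\mathrm{End}_R(U)$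 is the $R$-subalgebra generated by the coefficients in $x$ of all $T_{ab}(x)$, localised at $T_{11}(x)$, i.e. containing also the coefficients of $T_{11}(x)^{-1}$ expanded in powers of $x^{-1}$ (on $U_{k,n}$, $T_{11}(x)=x^k(1+O(x^{-1}))$). The basis vector of $U_{k,n}$ with $\varepsilon_1$ exactly at the positions $w_1<\cdots<w_k$ is labelled by $w=[w_1\ldots w_n]\in S^{k,n}$ ($w_{k+1}<\cdots<w_n$ the remaining positions), equivalently by the partition $\lambda(w)$ with $w_j=\lambda_{k+1-j}+j$, and is identified with the Schubert class $\sigma_w$ of $qH_T^*(\mathrm{Gr}(k;n))$ (map $\Xi$) and with $v_{w_1}\wedge\cdots\wedge v_{w_k}\in\bigwedge^kR^n$ (via the Satake map $\Sigma$, $v_{w_1}\wedge\cdots\wedge v_{w_k}\mapsto\sigma_w$). Dual Yang-Baxter algebra: let $\Theta:U\to U$ be the anti-linear bijection sending $f\cdot(\text{basis vector of }U_{k,n}\text{ labelled }\lambda)$ to $f'\cdot(\text{basis vector of }U_{n-k,n}\text{ labelled by the conjugate partition }\lambda')$, where $f'(y_1,\ldots,y_n;q)=f(-y_n,\ldots,-y_1;q)$. The dual monodromy matrix elements are $T'_{ba}(x)=\Theta\circ T_{ab}(x)\circ\Theta^{-1}$, and $\mathcal{Y}'\subset\mathrm{End}_R(U)$ is the $R$-subalgebra generated by their coefficients, localised at $T'_{11}(x)$ in the same sense. Fermionic operators: on $\bigwedge R^n$ let $\psi_j^*=v_j\wedge\cdot$ and $\psi_j(v_{i_1}\wedge\cdots\wedge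 v_{i_k})=\sum_r(-1)^{r-1}\delta_{j,i_r}v_{i_1}\wedge\cdots\widehat{v_{i_r}}\cdots\wedge v_{i_k}$. Then $\gamma_j,\gamma_j^*\in\mathrm{End}_R(U)$ are the operators corresponding to $\psi_j,\psi_j^*$ under the identification $\Xi^{-1}\circ\Sigma:\bigwedge R^n\to U$. *)

(* Defs.v *)
From HB Require Import structures.
From mathcomp Require Import all_boot all_order all_algebra.
From mathcomp Require Import generic_quotient.
From mathcomp Require Import zify ring.
From mathcomp Require mpoly.

Set Implicit Arguments.
Unset Strict Implicit.
Unset Printing Implicit Defensive.

Import GRing.Theory.
Local Open Scope ring_scope.
Local Open Scope quotient_scope.

(* Laurent polynomials A[q^{+-1}] as the localisation of {poly A} at 'X: the
   pair (p, m) stands for p / q^m. *)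
Section Laurent.
Variable A : comNzRingType.

Local Notation pre := ({poly A} * nat)%type.

Definition lequiv (a b : pre) := a.1 * 'X^(b.2) == b.1 * 'X^(a.2).

Lemma lequiv_refl : reflexive lequiv.
Proof. by move=> a; rewrite /lequiv. Qed.

Lemma lequiv_sym : symmetric lequiv.
Proof. by move=> a b; rewrite /lequiv eq_sym. Qed.

Lemma lequiv_trans : transitive lequiv.
Proof.
move=> b a c; rewrite /lequiv => /eqP ab /eqP bc; apply/eqP.
apply: (monic_rreg (monicXn A b.2)) => /=.
by rewrite mulrAC ab mulrAC bc mulrAC.
Qed.

Canonical lequiv_equiv := EquivRel lequiv lequiv_refl lequiv_sym lequiv_trans.

Definition laurent := {eq_quot lequiv}.
HB.instance Definition _ : EqQuotient _ lequiv laurent := EqQuotient.on laurent.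
HB.instance Definition _ := Choice.on laurent.

Definition lfrac (p : {poly A}) (m : nat) : laurent := \pi_laurent (p, m).

Lemma lfracP p m p' m' :
  reflect (p * 'X^m' = p' * 'X^m) (lfrac p m == lfrac p' m').
Proof. by rewrite /lfrac eqmodE; apply: eqP. Qed.

Lemma lfracW (P : laurent -> Prop) : (forall p m, P (lfrac p m)) -> forall a, P a.
Proof. by move=> H; elim/quotW => -[p m]; apply: H. Qed.

Lemma repr_lfrac p m :
  (repr (lfrac p m)).1 * 'X^m = p * 'X^((repr (lfrac p m)).2).
Proof.
have : \pi_laurent (repr (lfrac p m)) == \pi_laurent (p, m).
  by rewrite reprK.
by rewrite eqmodE => /eqP.
Qed.

Definition ladd (a b : laurent) : laurent :=
  lfrac ((repr a).1 * 'X^((repr b).2) + (repr b).1 * 'X^((repr a).2))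
        ((repr a).2 + (repr b).2).
Definition lopp (a : laurent) : laurent := lfrac (- (repr a).1) (repr a).2.
Definition lmul (a b : laurent) : laurent :=
  lfrac ((repr a).1 * (repr b).1) ((repr a).2 + (repr b).2).

Lemma laddE p m p' m' :
  ladd (lfrac p m) (lfrac p' m') = lfrac (p * 'X^m' + p' * 'X^m) (m + m').
Proof.
rewrite /ladd; move: (repr_lfrac p m) (repr_lfrac p' m').
case: (repr (lfrac p m)) (repr (lfrac p' m')) => [u k] [u' k'] /= e e'; apply/eqP/lfracP.
rewrite !exprD !mulrDl; congr (_ + _).
  transitivity ((u * 'X^m) * 'X^k' * 'X^m'); first by ring.
  by rewrite e; ring.
transitivity ((u' * 'X^m') * 'X^k * 'X^m); first by ring.
by rewrite e'; ring.
Qed.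

Lemma loppE p m : lopp (lfrac p m) = lfrac (- p) m.
Proof.
by apply/eqP/lfracP; rewrite !mulNr repr_lfrac.
Qed.

Lemma lmulE p m p' m' : lmul (lfrac p m) (lfrac p' m') = lfrac (p * p') (m + m').
Proof.
rewrite /lmul; move: (repr_lfrac p m) (repr_lfrac p' m').
case: (repr (lfrac p m)) (repr (lfrac p' m')) => [u k] [u' k'] /= e e'; apply/eqP/lfracP.
rewrite !exprD; transitivity ((u * 'X^m) * (u' * 'X^m')); first by ring.
by rewrite e e'; ring.
Qed.

Lemma laddA : associative ladd.
Proof.
elim/lfracW=> p m; elim/lfracW=> p' m'; elim/lfracW=> p'' m''.
by rewrite !laddE addnA !exprD; congr lfrac; ring.
Qed.

Lemma laddC : commutative ladd.
Proof.
by elim/lfracW=> p m; elim/lfracW=> p' m'; rewrite !laddE addnC addrC.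
Qed.

Lemma ladd0 : left_id (lfrac 0 0) ladd.
Proof.
by elim/lfracW=> p m; rewrite laddE mul0r add0r expr0 mulr1.
Qed.

Lemma laddN : left_inverse (lfrac 0 0) lopp ladd.
Proof.
elim/lfracW=> p m; rewrite loppE laddE; apply/eqP/lfracP.
by rewrite mulNr addNr !mul0r.
Qed.

HB.instance Definition _ :=
  GRing.isZmodule.Build laurent laddA laddC ladd0 laddN.

Lemma lmulA : associative lmul.
Proof.
elim/lfracW=> p m; elim/lfracW=> p' m'; elim/lfracW=> p'' m''.
by rewrite !lmulE addnA mulrA.
Qed.

Lemma lmulC : commutative lmul.
Proof.
by elim/lfracW=> p m; elim/lfracW=> p' m'; rewrite !lmulE addnC mulrC.
Qed.

Lemma lmul1 : left_id (lfrac 1 0) lmul.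
Proof. by elim/lfracW=> p m; rewrite lmulE mul1r. Qed.

Lemma lmulDl : left_distributive lmul ladd.
Proof.
elim/lfracW=> p m; elim/lfracW=> p' m'; elim/lfracW=> p'' m''.
by rewrite !(lmulE, laddE); apply/eqP/lfracP; rewrite !exprD; ring.
Qed.

Lemma lone_neq0 : lfrac 1 0 != lfrac 0 0.
Proof. by apply/lfracP => /eqP; rewrite !expr0 !mulr1 oner_eq0. Qed.

HB.instance Definition _ :=
  GRing.Zmodule_isComNzRing.Build laurent lmulA lmulC lmul1 lmulDl lone_neq0.

Definition laurentC (a : A) : laurent := lfrac a%:P 0.

(* The map induced by f on coefficients, fixing q. *)
Definition lmap (f : A -> A) (a : laurent) : laurent :=
  lfrac (map_poly f (repr a).1) (repr a).2.

Section LmapMorphism.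
Variable f : {rmorphism A -> A}.

Lemma lmapE p m : lmap f (lfrac p m) = lfrac (map_poly f p) m.
Proof.
apply/eqP/lfracP; move: (congr1 (map_poly f) (repr_lfrac p m)).
by rewrite !rmorphM /= !map_polyXn.
Qed.

Lemma lmap_is_zmod_morphism : zmod_morphism (lmap f).
Proof.
elim/lfracW=> p m; elim/lfracW=> p' m'.
rewrite -[_ - lfrac _ _]/(ladd _ (lopp _)) loppE laddE !lmapE.
rewrite -[RHS]/(ladd _ (lopp _)) loppE laddE.
by rewrite rmorphD !rmorphM /= rmorphN /= !map_polyXn.
Qed.

Lemma lmap_is_monoid_morphism : monoid_morphism (lmap f).
Proof.
split; first by rewrite -[1]/(lfrac 1 0) lmapE rmorph1.
elim/lfracW=> p m; elim/lfracW=> p' m'.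
by rewrite -[_ * lfrac _ _]/(lmul _ _) lmulE !lmapE rmorphM -lmulE.
Qed.

HB.instance Definition _ := GRing.isZmodMorphism.Build laurent laurent (lmap f)
  lmap_is_zmod_morphism.
HB.instance Definition _ := GRing.isMonoidMorphism.Build laurent laurent (lmap f)
  lmap_is_monoid_morphism.

End LmapMorphism.

End Laurent.

Import mpoly.

Section BaseRing.
Variable n : nat.

(* Z[y_1, ..., y_n][q^{+-1}] *)
Definition baseR : comNzRingType := laurent {mpoly int[n]}.

Definition yvar (i : 'I_n) : baseR := laurentC 'X_i.

(* f(y_1, ..., y_n; q) |-> f(- y_n, ..., - y_1; q) *)
Definition ysubst (p : {mpoly int[n]}) : {mpoly int[n]} :=
  p \mPo [tuple - 'X_(rev_ord i) | i < n].
HB.instance Definition _ := GRing.RMorphism.copy ysubst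
  (comp_mpoly [tuple - 'X_(rev_ord i) | i < n]).
Definition bar : baseR -> baseR := lmap ysubst.
HB.instance Definition _ := GRing.RMorphism.copy bar (lmap ysubst).

Lemma ysubstK : involutive ysubst.
Proof.
move=> p; rewrite {2}/ysubst comp_mpolyEX raddf_sum /=.
rewrite -[RHS]comp_mpoly_id [RHS]comp_mpolyEX; apply: eq_bigr => m _.
rewrite {1}/ysubst comp_mpolyZ -/(ysubst _) !comp_mpolyX rmorph_prod; congr (_ *: _).
apply: eq_bigr => i _; rewrite rmorphXn /= !tnth_mktuple rmorphN /=.
by rewrite {1}/ysubst comp_mpolyXU -tnth_nth tnth_mktuple rev_ordK opprK.
Qed.

Lemma barK : involutive bar.
Proof.
elim/lfracW=> p m; rewrite /bar (lmapE _ p m) lmapE -map_poly_comp; congr lfrac.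
by rewrite map_poly_id // => x _; apply: ysubstK.
Qed.

End BaseRing.

Section FreeModule.
Variable R : comNzRingType.

(* The free R-module with basis (fvec b)_{b : B}. *)
Definition free_mod (B : finType) := {ffun B -> R^o}.

Definition fvec (B : finType) (b : B) : free_mod B := [ffun c => (c == b)%:R].

Lemma free_modE (B : finType) (a : R) (u v : free_mod B) b :
  (a *: u + v) b = a * u b + v b.
Proof. by rewrite !ffunE. Qed.

Definition lin_ext (B C : finType) (g : B -> free_mod C) :
    'Hom(free_mod B, free_mod C) :=
  linfun (fun u : free_mod B => \sum_b u b *: g b).

Lemma lin_extE (B C : finType) (g : B -> free_mod C) u :
  lin_ext g u = \sum_b u b *: g b.
Proof.
pose h (u : free_mod B) := \sum_b u b *: g b.
have hl : linear h.
  move=> a v w; rewrite /h scaler_sumr -big_split; apply: eq_bigr => b _.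
  by rewrite !ffunE scalerDl scalerA.
pose hM := GRing.isLinear.Build _ _ _ _ h hl.
pose hL : {linear _ -> _} := HB.pack h hM.
exact: (lfunE hL).
Qed.

Lemma lin_ext_fvec (B C : finType) (g : B -> free_mod C) b :
  lin_ext g (fvec b) = g b.
Proof.
rewrite lin_extE (bigD1 b) //= ffunE eqxx scale1r big1 ?addr0 // => c /negbTE cb.
by rewrite ffunE cb scale0r.
Qed.

Lemma free_mod_sum (B : finType) (u : free_mod B) : u = \sum_b u b *: fvec b.
Proof.
apply/ffunP => c; rewrite sum_ffunE (bigD1 c) //= !ffunE eqxx big1 => [|b bc].
  by rewrite addr0 [RHS]mulr1.
by rewrite !ffunE eq_sym (negbTE bc) [LHS]mulr0.
Qed.

End FreeModule.

Section TensorSpace.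
Variables (R : comNzRingType) (n : nat).

Definition word := {ffun 'I_n -> 'I_2}.

(* U, with fvec alpha the vector eps_(alpha 1) (x) ... (x) eps_(alpha n) *)
Definition tens := free_mod R word.

Definition set_letter (alpha : word) (i : 'I_n) (b : 'I_2) : word :=
  [ffun j => if j == i then b else alpha j].

(* End_R(U), as an R-algebra with product f * g = f \o g *)
Definition endU := 'End(tens).

Lemma tens_proper : (0 < dim tens)%N.
Proof. by rewrite /dim /= muln1 card_ffun !card_ord expn_gt0. Qed.

HB.instance Definition _ := GRing.Lmodule.on endU.
HB.instance Definition _ := GRing.Zmodule_isNzRing.Build endU
  (@comp_lfunA _ _ _ _ _) (@comp_lfun1l _ _ _) (@comp_lfun1r _ _ _)
  (@comp_lfunDl _ _ _ _) (@comp_lfunDr _ _ _ _) (lfun1_neq0 tens_proper).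
HB.instance Definition _ := GRing.Lmodule_isLalgebra.Build R endU
  (@comp_lfunZl R tens tens tens).
HB.instance Definition _ := GRing.Lalgebra_isAlgebra.Build R endU
  (@comp_lfunZr R tens tens tens).

Lemma endU_mulE (f g : endU) (u : tens) : (f * g) u = f (g u).
Proof. exact: comp_lfunE. Qed.

(* The operator M acting on the i-th tensor factor; column b of M holds the
   image of eps_b. *)
Definition site_op (i : 'I_n) (M : 'M[R]_2) : endU :=
  lin_ext (fun alpha : word => \sum_b M b (alpha i) *: fvec R (set_letter alpha i b)).

(* L(x, y); the variable x is 'X *)
Definition Lax (y : R) : 'M[{poly 'M[R]_2}]_2 :=
  let E (a b : 'I_2) : 'M[R]_2 := delta_mx a b in
  \matrix_(a, b)
    if a == 0 then
      if b == 0 then (E 0 0)%:P + ('X + y%:M%:P) * (E 1 1)%:P else (E 1 0)%:P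
    else if b == 0 then (E 0 1)%:P else (E 1 1)%:P.

Variable y : 'I_n -> R.

Definition Lsite (i : 'I_n) : 'M[{poly endU}]_2 :=
  map_mx (map_poly (site_op i)) (Lax (y i)).

(* L_{0n}(x, y_n) ... L_{01}(x, y_1) *)
Definition monodromy : 'M[{poly endU}]_2 :=
  \prod_(i <- rev (enum 'I_n)) Lsite i.

End TensorSpace.

Section Subalgebras.
Variables (R : comNzRingType) (A : algType R).

Inductive subalg_gen (G : A -> Prop) : A -> Prop :=
| SubalgGen a of G a : subalg_gen G a
| SubalgOne : subalg_gen G 1
| SubalgAdd a b of subalg_gen G a & subalg_gen G b : subalg_gen G (a + b)
| SubalgScale c a of subalg_gen G a : subalg_gen G (c *: a)
| SubalgMul a b of subalg_gen G a & subalg_gen G b : subalg_gen G (a * b).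

(* S d is the coefficient of x^d in a formal Laurent series in x^-1 (only
   finitely many positive powers of x). There is at most one such series
   inverse to p, and there is one for p = T_11(x), which is x^k (1 + O(x^-1))
   on U_{k,n} for every k. *)
Definition laurent_inverse (p : {poly A}) (S : int -> A) : Prop :=
  [/\ exists N : int, forall d : int, (N < d)%R -> S d = 0,
      forall d : int, \sum_(i < size p) p`_i * S (d - i%:Z) = (d == 0)%:R
    & forall d : int, \sum_(i < size p) S (d - i%:Z) * p`_i = (d == 0)%:R].

Inductive yb_generator (T : 'M[{poly A}]_2) : A -> Prop :=
| YBCoef (a b : 'I_2) (m : nat) : yb_generator T (T a b)`_m
| YBInvCoef (S : int -> A) (d : int) of laurent_inverse (T 0 0) S :
    yb_generator T (S d).

Definition yang_baxter (T : 'M[{poly A}]_2) : A -> Prop :=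
  subalg_gen (yb_generator T).

End Subalgebras.

Section Partitions.
Variable n : nat.
Implicit Type alpha : word n.

Definition ones alpha : seq nat := [seq val i | i <- enum 'I_n & alpha i == 1].

(* With positions numbered from 0, the partition lambda of alpha has
   lambda_(k - j) = w_j - j for 0 <= j < k = size (ones alpha); it is listed in
   non-increasing order, padded with zeros to length k. *)
Definition part_of_word alpha : seq nat :=
  rev (mkseq (fun j => nth 0%N (ones alpha) j - j)%N (size (ones alpha))).

Definition word_of_part (l : seq nat) : word n :=
  [ffun i : 'I_n => if val i \in mkseq (fun j => nth 0%N (rev l) j + j)%N (size l)
                     then 1 else 0].

Definition conj_part (m : nat) (l : seq nat) : seq nat :=
  mkseq (fun i => count (fun p => i < p)%N l) m.

(* The conjugate of a partition in the k x (n - k) box, padded to length n - k *)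
Definition conj_word alpha : word n :=
  word_of_part (conj_part (n - size (ones alpha)) (part_of_word alpha)).

Lemma mem_ones alpha (i : 'I_n) : (val i \in ones alpha) = (alpha i == 1).
Proof.
by rewrite (mem_map val_inj) mem_filter mem_enum andbT.
Qed.

Lemma ones_lt alpha j : (j < size (ones alpha))%N -> (nth 0%N (ones alpha) j < n)%N.
Proof.
by move=> /(mem_nth 0%N) /mapP[i _ ->]; apply: ltn_ord.
Qed.

Lemma ones_gap alpha a b : (a <= b)%N -> (b < size (ones alpha))%N ->
  (nth 0%N (ones alpha) a + (b - a) <= nth 0%N (ones alpha) b)%N.
Proof.
have sorted_ones : sorted ltn (ones alpha).
  have sub : subseq (ones alpha) (iota 0 n).
    by rewrite -val_enum_ord; apply/map_subseq/filter_subseq.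
  exact: (subseq_sorted ltn_trans sub (iota_ltn_sorted _ _)).
elim: b => [|b IHb] ab bk.
  by move: ab; rewrite leqn0 => /eqP ->; rewrite subnn addn0.
move: ab; rewrite leq_eqVlt => /orP[/eqP->|ab]; first by rewrite subnn addn0 leqnn.
have := IHb ab (ltnW bk).
have := sorted_ltn_nth ltn_trans 0%N sorted_ones.
move=> /(_ b b.+1); rewrite !inE => /(_ (ltnW bk) bk (ltnSn b)).
lia.
Qed.

Lemma size_ones alpha : (size (ones alpha) <= n)%N.
Proof.
case E: (size _) => [//|k].
have lek : (k < size (ones alpha))%N by rewrite E.
have := ones_lt lek; have := ones_gap (leq0n k) lek; lia.
Qed.

Lemma count_threshold (f : nat -> nat) k c i :
  (forall j, (j < k)%N -> (i < f j)%N = (c <= j)%N) ->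
  count (fun p => i < p)%N (mkseq f k) = (k - c)%N.
Proof.
move=> fc; rewrite count_map.
rewrite (eq_in_count (a2 := leq c)) => [|j]; last first.
  by rewrite mem_iota /= => jk; apply: fc.
by elim: k {fc} => // k IH; rewrite -[k.+1]addn1 iotaD count_cat IH /=; lia.
Qed.

Lemma conj_wordE alpha i :
  conj_word alpha i = if alpha (rev_ord i) == 1 then 0 else 1.
Proof.
rewrite ffunE; set W := mkseq _ _.
suff -> : (val i \in W) = (alpha (rev_ord i) != 1) by case: eqP.
rewrite -mem_ones /=; have ilt := ltn_ord i.
have kn := size_ones alpha; set s := ones alpha in kn *; set k := size s in kn *.
have nthW j : (j < n - k)%N -> nth 0%N (rev (conj_part (n - k) (part_of_word alpha))) j
    = count (fun p => n - k - j.+1 < p)%N (mkseq (fun j => nth 0%N s j - j)%N k).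
  move=> jlt; rewrite nth_rev ?size_mkseq // nth_mkseq; last by lia.
  by rewrite /part_of_word count_rev.
have sizeW : size (conj_part (n - k) (part_of_word alpha)) = (n - k)%N.
  by rewrite size_mkseq.
apply/idP/idP.
- rewrite /W -/s -/k sizeW => /mapP[j]; rewrite mem_iota /= add0n => jlt ->.
  rewrite nthW //; set t := (n - k - j.+1)%N.
  pose f j := (nth 0%N s j - j)%N.
  pose c := find (fun p => t < p)%N (mkseq f k).
  have ck : (c <= k)%N by rewrite -[X in (_ <= X)%N](size_mkseq f k) find_size.
  have fc a : (a < k)%N -> (t < f a)%N = (c <= a)%N.
    move=> ak; case: (leqP c a) => ca; last first.
      by have := before_find 0%N ca; rewrite nth_mkseq.
    have clt : (c < k)%N by exact: leq_ltn_trans ca ak.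
    have : (c < size (mkseq f k))%N by rewrite size_mkseq.
    rewrite -has_find => /(nth_find 0%N).
    rewrite -/c nth_mkseq // /f => tc.
    have := ones_gap ca ak; rewrite -/s; lia.
  rewrite (count_threshold fc); apply/negP => /(nthP 0%N)[a ak sa].
  have := fc a ak; have := ones_gap (leq0n a) ak; rewrite -/s /f sa /t.
  rewrite /t in fc; case: (leqP c a); lia.
- move=> hole; set h := (n - i.+1)%N in hole.
  pose c := find (fun x => h < x)%N s.
  have ck : (c <= k)%N by exact: find_size.
  have fc a : (a < k)%N -> (h < nth 0%N s a)%N = (c <= a)%N.
    move=> ak; case: (leqP c a) => ca; last exact: before_find.
    have clt : (c < size s)%N by exact: leq_ltn_trans ca ak.
    have := clt; rewrite -has_find => /(nth_find 0%N); rewrite -/c => tc.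
    have := ones_gap ca ak; rewrite -/s; lia.
  have neh a : (a < k)%N -> nth 0%N s a != h.
    by move=> ak; apply: contraNneq hole => <-; apply: mem_nth.
  have ch : (c <= h)%N.
    case E: c => [//|c'].
    have c'k : (c' < k)%N by lia.
    have := fc _ c'k; have := neh _ c'k; have := ones_gap (leq0n c') c'k; rewrite -/s; lia.
  have hc : (h - c < n - k)%N.
    move: ck; rewrite leq_eqVlt => /orP[/eqP e|clt].
      by rewrite /h in ch *; lia.
    have kk : (k.-1 < k)%N by lia.
    have := fc _ clt; have ck1 : (c <= k.-1)%N by lia.
    have := ones_gap ck1 kk; have := ones_lt kk; rewrite -/s; lia.
  apply/mapP; exists (n - k - (h - c).+1)%N.
    by rewrite mem_iota /= -/s -/k sizeW; lia.
  rewrite -/s -/k nthW; last by lia.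
  rewrite (@count_threshold _ _ c); last first.
    move=> a ak; have := fc _ ak; have := neh _ ak.
    case: (leqP c a) => ca.
      have clt : (c < k)%N by exact: leq_ltn_trans ca ak.
      have := fc _ clt; have := ones_gap ca ak; rewrite -/s; lia.
    have c1 : (c.-1 < k)%N by lia.
    have ac : (a <= c.-1)%N by lia.
    have := fc _ c1; have := neh _ c1; have := ones_gap ac c1; rewrite -/s; lia.
  rewrite /h in ch hc *; lia.
Qed.

Lemma conj_wordK : involutive conj_word.
Proof.
move=> alpha; apply/ffunP => i; rewrite !conj_wordE rev_ordK.
by case: (alpha i) => -[|[|?]] ? //=; apply/val_inj.
Qed.

End Partitions.

Section Exterior.
Variables (R : comNzRingType) (n : nat).

(* The exterior algebra of R^n, with basis v_{i_1} /\ ... /\ v_{i_k} for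
   {i_1 < ... < i_k} in {set 'I_n}. *)
Definition extalg := free_mod R {set 'I_n}.

Fixpoint inversions (s : seq 'I_n) : nat :=
  if s is i :: s' then (count (fun j : 'I_n => j < i)%N s' + inversions s')%N else 0%N.

(* v_{i_1} /\ ... /\ v_{i_k} for an arbitrary sequence i_1, ..., i_k *)
Definition wedge (s : seq 'I_n) : extalg :=
  if uniq s then (-1) ^+ inversions s *: fvec R [set i in s] else 0.

Definition psi_star (j : 'I_n) : 'End(extalg) :=
  lin_ext (fun I : {set 'I_n} => wedge (j :: enum I)).

(* r is numbered from 0, hence the sign (-1)^r instead of (-1)^(r-1). *)
Definition psi (j : 'I_n) : 'End(extalg) :=
  lin_ext (fun I : {set 'I_n} => let s := enum I in
    \sum_(r < size s)
      ((-1) ^+ r * (nth j s r == j)%:R) *: wedge (take r s ++ drop r.+1 s)).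

(* The identification of the exterior algebra with U (through the Satake map
   and the Schubert basis) sends v_{w_1} /\ ... /\ v_{w_k} to the basis vector
   with eps_1 exactly at the positions w_1 < ... < w_k. *)
Definition ext_to_tens : 'Hom(extalg, tens R n) :=
  lin_ext (fun I : {set 'I_n} =>
    fvec R [ffun i => if i \in I then 1 else 0 : 'I_2]).
Definition tens_to_ext : 'Hom(tens R n, extalg) :=
  lin_ext (fun alpha : word n => fvec R [set i | alpha i == 1]).

Lemma ext_to_tensK : cancel ext_to_tens tens_to_ext.
Proof.
move=> u; rewrite [ext_to_tens u]lin_extE linear_sum /= [RHS]free_mod_sum.
apply: eq_bigr => I _; rewrite linearZ /= lin_ext_fvec; congr (_ *: fvec R _).
by apply/setP => i; rewrite inE ffunE; case: (i \in I).
Qed.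

Lemma tens_to_extK : cancel tens_to_ext ext_to_tens.
Proof.
move=> u; rewrite [tens_to_ext u]lin_extE linear_sum /= [RHS]free_mod_sum.
apply: eq_bigr => alpha _; rewrite linearZ /= lin_ext_fvec; congr (_ *: fvec R _).
apply/ffunP => i; rewrite ffunE inE.
by case: (alpha i) => -[|[|?]] ? //=; apply/val_inj.
Qed.

Definition gamma (j : 'I_n) : endU R n :=
  (ext_to_tens \o (psi j \o tens_to_ext))%VF.
Definition gamma_star (j : 'I_n) : endU R n :=
  (ext_to_tens \o (psi_star j \o tens_to_ext))%VF.

Inductive fermion : endU R n -> Prop :=
| FermionGamma j : fermion (gamma j)
| FermionGammaStar j : fermion (gamma_star j).

End Exterior.

(* Theta for a ring involution bar of R: f * eps_alpha is sent to
   bar f * eps_(conj_word alpha). *)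
Section Theta.
Variables (R : comNzRingType) (n : nat) (bar : {rmorphism R -> R}).
Hypothesis barK : involutive bar.

Definition Theta (u : tens R n) : tens R n :=
  \sum_alpha bar (u alpha) *: fvec R (conj_word alpha).

(* X |-> Theta o X o Theta^-1, as Theta^-1 = Theta (ThetaK below) *)
Definition Theta_conj (X : endU R n) : endU R n := linfun (Theta \o X \o Theta).

Lemma ThetaE u beta : Theta u beta = bar (u (conj_word beta)).
Proof.
rewrite /Theta sum_ffunE (bigD1 (conj_word beta)) //= big1 => [|alpha ne].
  by rewrite addr0 !ffunE conj_wordK eqxx [LHS]mulr1.
rewrite !ffunE; case: eqP => [e|_]; last by rewrite [LHS]mulr0.
by rewrite e conj_wordK eqxx in ne.
Qed.

Lemma ThetaK : involutive Theta.
Proof.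
by move=> u; apply/ffunP => beta; rewrite !ThetaE conj_wordK barK.
Qed.

Lemma Theta_semilinear a u v :
  Theta (a *: u + v) = bar a *: Theta u + Theta v.
Proof.
by apply/ffunP => b; rewrite free_modE !ThetaE free_modE rmorphD rmorphM.
Qed.

Lemma Theta_conjE X u : Theta_conj X (Theta u) = Theta (X u).
Proof.
have hl : linear (Theta \o X \o Theta).
  move=> a v w; rewrite /= Theta_semilinear.
  have -> : X (bar a *: Theta v + Theta w) = bar a *: X (Theta v) + X (Theta w).
    exact: (linearP (X : 'Hom(tens R n, tens R n))).
  by rewrite Theta_semilinear barK.
pose hM := GRing.isLinear.Build _ _ _ _ (Theta \o X \o Theta) hl.
pose hL : {linear _ -> _} := HB.pack (Theta \o X \o Theta) hM.
by rewrite [LHS](lfunE hL) /= ThetaK.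
Qed.

End Theta.

Section Algebras.
Variable n : nat.
Local Notation End := (endU (baseR n) n).

Definition T : 'M[{poly End}]_2 := monodromy (@yvar n).

(* T'_{ba}(x) = Theta o T_{ab}(x) o Theta^-1 *)
Definition T' : 'M[{poly End}]_2 :=
  (map_mx (map_poly (Theta_conj (@bar n))) T)^T.

Definition YBalg : End -> Prop := yang_baxter T.
Definition dualYBalg : End -> Prop := yang_baxter T'.
Definition fermion_alg : End -> Prop := subalg_gen (@fermion (baseR n) n).

End Algebras.

(* Main.v *)
Require Import Defs.
From mathcomp Require Import all_boot all_order all_algebra.
From mathcomp Require Import zify ring.

Set Implicit Arguments.
Unset Strict Implicit.
Unset Printing Implicit Defensive.

Import GRing.Theory.
Local Open Scope ring_scope.

(** All three algebras are the whole of [End_R(U)].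

    An algebra of operators is everything as soon as, for one basis vector [w],
    it contains the matrix units of the column of [w] and of the row of [w]
    ([subalg_gen_full]).  So one needs a rank-one idempotent at [w], then enough
    operators to create every basis vector from [w], and the same for the
    transposes.

    For the fermions [w] is the vacuum: up to sign its idempotent is the product
    of the [gamma_j gamma_j^*], and [gamma_j^*], [gamma_j] move along its column
    and its row ([fermion_subalg_full]).

    For the Yang-Baxter algebra [w] is the word with all letters 1, whose
    idempotent is the coefficient of [x^n] in [T_11] ([top_coef]).  Read the
    product of the [L_0i] as a carrier that crosses the sites from left to right,
    its load being the state of the auxiliary space.  An empty carrier either
    passes a particle, with weight [x + y_i], or picks it up; a loaded carrier
    passes every particle and must drop its load at the first hole.  In [T_21]
    the carrier starts empty and ends loaded.  Let [I] have a particle at [h] and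
    let [d] be the number of its particles to the left of [h].  Among the words
    without a hole to the right of [h], only [I] with a new hole at [h] can occur
    in the coefficient of [x^d] of [T_21] applied to [I]: the carrier has to pass
    all these [d] particles before it picks up, so it picks up at [h]
    ([amplitude_pickup]).  If [I] is full to the right of [h], that coefficient is
    therefore [I] with a new hole at [h], plus words whose last hole is further
    right, and a double induction on the number of holes and the position of the
    last one creates every word
    ([column_units]).

    The row of [w] comes for free: transposition combined with the reversal of
    the sites is an anti-automorphism that sends [T_ab] for [y] to [T_ba] for the
    reversed [y] ([flip_monodromy]).  For the dual algebra, conjugation by
    [Theta] is a semilinear ring automorphism, so it maps everything onto
    everything ([dual_coef_subalg_full]). *)

(** * Matrix units and the density criterion *)

Section MatrixUnits.
Variables (R : comNzRingType) (n : nat).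
Local Notation End := (endU R n).
Implicit Types (X Y : End) (a b c : word n).

Definition entry X a b : R := X (fvec R b) a.

Lemma apply_entry X (u : tens R n) a : X u a = \sum_b entry X a b * u b.
Proof.
rewrite {1}[u]free_mod_sum linear_sum sum_ffunE; apply: eq_bigr => b _.
by rewrite linearZ ffunE mulrC.
Qed.

Lemma entry_inj X Y : (forall a b, entry X a b = entry Y a b) -> X = Y.
Proof.
move=> XY; apply/lfunP => u; apply/ffunP => a.
by rewrite !apply_entry; apply: eq_bigr => b _; rewrite XY.
Qed.

Lemma entry0 a b : entry 0 a b = 0.
Proof. by rewrite /entry zero_lfunE ffunE. Qed.

Lemma entry1 a b : entry 1 a b = (a == b)%:R.
Proof. by rewrite /entry id_lfunE ffunE. Qed.

Lemma entryD X Y a b : entry (X + Y) a b = entry X a b + entry Y a b.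
Proof. by rewrite /entry add_lfunE ffunE. Qed.

Lemma entryZ (r : R) X a b : entry (r *: X) a b = r * entry X a b.
Proof. by rewrite /entry scale_lfunE ffunE. Qed.

Lemma entry_sum (I : Type) (s : seq I) (P : pred I) (F : I -> End) a b :
  entry (\sum_(i <- s | P i) F i) a b = \sum_(i <- s | P i) entry (F i) a b.
Proof.
by apply: (big_morph (fun X => entry X a b)) => [X Y|]; rewrite ?entryD ?entry0.
Qed.

Lemma entryM X Y a c : entry (X * Y) a c = \sum_b entry X a b * entry Y b c.
Proof. by rewrite /entry endU_mulE apply_entry. Qed.

Definition matrix_unit a b : End :=
  lin_ext (fun c : word n => (c == b)%:R *: fvec R a).

Lemma entry_matrix_unit a b c d :
  entry (matrix_unit a b) c d = (c == a)%:R * (d == b)%:R.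
Proof. by rewrite /entry lin_ext_fvec !ffunE mulrC. Qed.

Lemma mul_matrix_unit X a b :
  X * matrix_unit a b = \sum_c entry X c a *: matrix_unit c b.
Proof.
apply: entry_inj => d e; rewrite entryM entry_sum (bigD1 a) //= big1 => [|c ca].
  rewrite (bigD1 d) //= big1 => [|c cd].
    by rewrite entryZ !entry_matrix_unit !eqxx !mul1r !addr0.
  by rewrite entryZ entry_matrix_unit eq_sym (negbTE cd) mul0r mulr0.
by rewrite entry_matrix_unit (negbTE ca) mul0r mulr0.
Qed.

Lemma mul_unit_col X a b c (r : R) :
  X (fvec R a) = r *: fvec R b -> X * matrix_unit a c = r *: matrix_unit b c.
Proof.
move=> Xa; rewrite mul_matrix_unit (bigD1 b) //= big1 => [|d db].
  by rewrite addr0 /entry Xa !ffunE eqxx [r *: _]mulr1.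
by rewrite /entry Xa !ffunE (negbTE db) [r *: _]mulr0 scale0r.
Qed.

Lemma mul_matrix_unitr X a b :
  matrix_unit a b * X = \sum_c entry X b c *: matrix_unit a c.
Proof.
apply: entry_inj => d e; rewrite entryM entry_sum (bigD1 b) //= big1 => [|c cb].
  rewrite (bigD1 e) //= big1 => [|c ce].
    by rewrite entryZ !entry_matrix_unit !eqxx !mulr1 !addr0 mulrC.
  by rewrite entryZ entry_matrix_unit [e == c]eq_sym (negbTE ce) !mulr0.
by rewrite entry_matrix_unit (negbTE cb) mulr0 mul0r.
Qed.

Variable G : End -> Prop.
Local Notation S := (subalg_gen G).

Lemma subalg_gen0 : S 0.
Proof. by rewrite -(scale0r 1); apply/SubalgScale/SubalgOne. Qed.

Lemma subalg_gen_sum (I : Type) (s : seq I) (P : pred I) (F : I -> End) :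
  (forall i, P i -> S (F i)) -> S (\sum_(i <- s | P i) F i).
Proof.
by move=> SF; apply: big_ind => //; [exact: subalg_gen0 | exact: SubalgAdd].
Qed.

(** The identity is the sum over [a] of the products of the units at [(a, w)] and
    [(w, a)], and [X] times a unit of the column of [w] is a combination of units
    of that column. *)
Lemma subalg_gen_full w : (forall a, S (matrix_unit a w)) ->
  (forall b, S (matrix_unit w b)) -> forall X, S X.
Proof.
move=> Sl Sr X; rewrite -[X]mulr1.
have -> : 1 = \sum_a matrix_unit a w * matrix_unit w a.
  apply: entry_inj => c d; rewrite entry_sum entry1 (bigD1 c) //= big1 => [|a ac].
    rewrite mul_matrix_unit entry_sum (bigD1 c) //= big1 => [|a ac].
      by rewrite entryZ !entry_matrix_unit !eqxx !mul1r !addr0 eq_sym.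
    by rewrite entryZ entry_matrix_unit (negbTE ac) !mul0r.
  rewrite entryM big1 // => b _.
  by rewrite entry_matrix_unit eq_sym (negbTE ac) !mul0r.
rewrite mulr_sumr; apply: subalg_gen_sum => a _; rewrite mulrA.
apply: SubalgMul => //; rewrite mul_matrix_unit.
by apply: subalg_gen_sum => c _; apply: SubalgScale.
Qed.

End MatrixUnits.

(** * The monodromy matrix, site by site *)

Section Words.
Variable n : nat.
Implicit Types (J : word n) (i : 'I_n).

Lemma letterP (b : 'I_2) : b = 0 \/ b = 1.
Proof. by case: b => -[|[|?]] //= ?; [left | right]; apply: val_inj. Qed.

Lemma letter_neq0 (b : 'I_2) : (b != 0) = (b == 1).
Proof. by case: b => -[|[|?]]. Qed.

Lemma set_letterE J i b j : set_letter J i b j = if j == i then b else J j.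
Proof. by rewrite ffunE. Qed.

Lemma set_letter_same J i b : set_letter J i b i = b.
Proof. by rewrite ffunE eqxx. Qed.

Lemma set_letter_id J i b : J i = b -> set_letter J i b = J.
Proof. by move=> <-; apply/ffunP => j; rewrite ffunE; case: eqP => [->|]. Qed.

Lemma set_letterK J i b c : set_letter (set_letter J i b) i c = set_letter J i c.
Proof. by apply/ffunP => j; rewrite !ffunE; case: eqP. Qed.

Definition weight J : nat := \sum_i J i.

Lemma weight_set_letter J i b : (weight (set_letter J i b) + J i = weight J + b)%N.
Proof.
rewrite /weight (bigD1 i) //= [in RHS](bigD1 i) //= set_letter_same.
rewrite (eq_bigr (fun j => J j : nat)) => [|j /negbTE ji]; first by rewrite addnC addnCA addnC.
by rewrite set_letterE ji.
Qed.

End Words.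

Section SiteOperators.
Variables (R : comNzRingType) (n : nat).
Implicit Types (M : 'M[R]_2) (I J : word n) (i : 'I_n).

Lemma site_opE i M (u : tens R n) J :
  site_op i M u J = \sum_b M (J i) b * u (set_letter J i b).
Proof.
rewrite /site_op lin_extE sum_ffunE (partition_big (fun K : word n => K i) predT) //=.
apply: eq_bigr => b _; rewrite (bigD1 (set_letter J i b)) ?set_letter_same //=.
rewrite [X in _ + X]big1 => [|K /andP[/eqP Kb neK]]; last first.
  rewrite ffunE sum_ffunE big1 ?[LHS]mulr0 // => c _; rewrite !ffunE.
  case: eqP => [JK|_]; last exact: mulr0.
  by case/eqP: neK; rewrite JK set_letterK set_letter_id.
rewrite addr0 ffunE sum_ffunE (bigD1 (J i)) //= big1 => [|c cJ].
  rewrite !ffunE addr0 set_letterK (@set_letter_id _ J i (J i)) // eqxx.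
  by rewrite [LHS]mulrC [_ *: _]mulr1.
rewrite !ffunE; case: eqP => [JK|_]; last exact: mulr0.
by case/eqP: cJ; rewrite JK set_letter_same.
Qed.

Lemma entry_site_op i M X J I :
  entry (site_op i M * X) J I = \sum_b M (J i) b * entry X (set_letter J i b) I.
Proof. by rewrite /entry endU_mulE site_opE. Qed.

Lemma site_op0 i : site_op i (0 : 'M[R]_2) = 0.
Proof.
apply: entry_inj => J I; rewrite entry0 -[site_op _ _]mulr1 entry_site_op.
by rewrite big1 // => b _; rewrite mxE mul0r.
Qed.

End SiteOperators.

Section Monodromy.
Variables (R : comNzRingType) (n : nat) (y : 'I_n -> R).
Implicit Types (I J : word n) (i : 'I_n) (P : {poly endU R n}).

Lemma coef_Lsite i a b m :
  (Lsite y i a b)`_m = site_op i ((Lax (y i) a b)`_m).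
Proof. by rewrite mxE coef_map_id0 ?site_op0. Qed.

Lemma coef_Lax_mul i a b P m J I :
  entry ((Lsite y i a b * P)`_m) J I =
  \sum_(k < m.+1) \sum_c (Lax (y i) a b)`_k (J i) c
                     * entry P`_(m - k) (set_letter J i c) I.
Proof.
rewrite coefM entry_sum; apply: eq_bigr => k _.
by rewrite coef_Lsite entry_site_op.
Qed.



Lemma entry_Lax00 (r : R) k (c d : 'I_2) : (Lax r 0 0)`_k c d =
  if c == d then if c == 0 then (k == 0%N)%:R
                 else (k == 1%N)%:R + (k == 0%N)%:R * r
  else 0.
Proof.
rewrite mxE /= coefD coefMC !mxE coefC big_ord_recl big_ord1 coefD coefX coefC.
rewrite !mxE.
case: k => [|[|k]] /=; case: c => -[|[|?]] //= ?; case: d => -[|[|?]] //= ?;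
 rewrite ?mxE /= ?(mulr0n, mulr1n, mulr1, mulr0, mul0r, addr0, add0r, mul1r) //.
Qed.

(** Off the diagonal corner [(0, 0)] the entries of [L] are constant and follow
    particle conservation: the carrier goes from [b] to [a] while the site goes
    from [a] to [b]. *)
Lemma entry_Lax_off (r : R) a b k (c d : 'I_2) : (a != 0) || (b != 0) ->
  (Lax r a b)`_k c d = ((k == 0%N) && (c == b) && (d == a))%:R.
Proof.
move=> ab; rewrite mxE.
case: a ab => -[|[|?]] //= ?; case: b => -[|[|?]] //= ? _;
  by rewrite coefC; case: (k == 0%N); rewrite !mxE.
Qed.

Lemma sum_linear_coefs (F : nat -> R) m : (forall k, F k.+2 = 0) ->
  \sum_(k < m.+1) F k = F 0%N + (if m is 0%N then 0 else F 1%N).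
Proof.
move=> F0; case: m => [|m]; first by rewrite big_ord1 addr0.
rewrite !big_ord_recl big1 ?addr0 // => k _; exact: (F0 k).
Qed.

Lemma entry_Lsite00 i P m J I : entry ((Lsite y i 0 0 * P)`_m) J I =
  if J i == 0 then entry P`_m J I
  else (if m is m'.+1 then entry P`_m' J I else 0) + y i * entry P`_m J I.
Proof.
pose F k := \sum_c (Lax (y i) 0 0)`_k (J i) c
                     * entry P`_(m - k) (set_letter J i c) I.
rewrite coef_Lax_mul (sum_linear_coefs (F := F)) => [|k]; last first.
  apply: big1 => c _; rewrite entry_Lax00 /=.
  by case: eqP; rewrite ?mul0r //; case: eqP; rewrite ?(addr0, mul0r).
have FE k : F k = (Lax (y i) 0 0)`_k (J i) (J i) * entry P`_(m - k) J I.
  rewrite /F (bigD1 (J i)) //= big1 => [|c /negbTE cJ].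
    by rewrite addr0 set_letter_id.
  by rewrite entry_Lax00 eq_sym cJ mul0r.
rewrite !FE !entry_Lax00 !eqxx subn0; case: ifP => _.
  by case: m {F FE} => [|m]; rewrite /= ?mul0r mul1r addr0.
by case: m {F FE} => [|m]; rewrite /= ?subn1 /=; ring.
Qed.

Lemma entry_Lsite_off i a b P m J I : (a != 0) || (b != 0) ->
  entry ((Lsite y i a b * P)`_m) J I =
  if J i == b then entry P`_m (set_letter J i a) I else 0.
Proof.
move=> ab; rewrite coef_Lax_mul big_ord_recl [X in _ + X]big1 => [|k _]; last first.
  by apply: big1 => c _; rewrite entry_Lax_off ?mul0r.
rewrite addr0 subn0 (bigD1 a) //= big1 => [|c /negbTE ca]; rewrite entry_Lax_off //=.
  by rewrite eqxx andbT addr0; case: eqP; rewrite ?mul1r ?mul0r.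
by rewrite ca andbF mul0r.
Qed.

Definition prefix_monodromy p := \prod_(i <- rev (take p (enum 'I_n))) Lsite y i.

Lemma prefix_monodromyS i :
  prefix_monodromy i.+1 = Lsite y i *m prefix_monodromy i.
Proof.
rewrite /prefix_monodromy (take_nth i) ?size_enum_ord // rev_rcons big_cons.
by rewrite nth_ord_enum.
Qed.

Lemma prefix_monodromy_full : prefix_monodromy n = monodromy y.
Proof. by rewrite /prefix_monodromy take_oversize ?size_enum_ord. Qed.

(** The weight with which a carrier with initial load [b] turns [I] into [J] and
    has load [a] once it has crossed the first [p] sites; [m] selects a power of
    [x]. *)
Definition amplitude p a b m J I := entry (prefix_monodromy p a b)`_m J I.

Lemma amplitude0 a b m J I :
  amplitude 0 a b m J I = ((a == b) && (m == 0%N) && (J == I))%:R.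
Proof.
rewrite /amplitude /prefix_monodromy take0 big_nil mxE coefMn coef1.
case: (a == b); rewrite ?entry0 //=; case: (m == 0%N); rewrite ?entry0 //.
by rewrite entry1.
Qed.

Lemma amplitudeS i a b m J I : amplitude i.+1 a b m J I =
  entry ((Lsite y i a 0 * prefix_monodromy i 0 b)`_m) J I
  + entry ((Lsite y i a 1 * prefix_monodromy i 1 b)`_m) J I.
Proof.
rewrite /amplitude prefix_monodromyS mxE big_ord_recl big_ord1 coefD entryD.
by have -> : lift ord0 ord0 = 1 :> 'I_2 by apply: val_inj.
Qed.

(** The next two lemmas list the last step of the carrier.  The letter of [J] at
    site [i] is already the output, so the input letter is restored by
    [set_letter]. *)
Lemma amplitudeS0 i b m J I : amplitude i.+1 0 b m J I =
  if J i == 0 then amplitude i 0 b m J I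
  else (if m is m'.+1 then amplitude i 0 b m' J I else 0)
       + y i * amplitude i 0 b m J I + amplitude i 1 b m (set_letter J i 0) I.
Proof.
rewrite amplitudeS entry_Lsite00 entry_Lsite_off //.
by rewrite -letter_neq0; case: ifP; rewrite /= ?addr0.
Qed.

Lemma amplitudeS1 i b m J I : amplitude i.+1 1 b m J I =
  if J i == 0 then amplitude i 0 b m (set_letter J i 1) I
  else amplitude i 1 b m J I.
Proof.
rewrite amplitudeS !entry_Lsite_off // -letter_neq0.
case: eqP => [_|/eqP]; first by rewrite addr0.
by rewrite letter_neq0 => /eqP J1; rewrite add0r set_letter_id.
Qed.


(** What a carrier that starts empty preserves: particles are conserved, the load
    included, and the sites from [p] on have not been visited. *)
Definition supported p (a : 'I_2) J I : bool :=
  (weight J + a == weight I)%N && [forall s : 'I_n, (p <= s)%N ==> (J s == I s)].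

Lemma supported_step i (a b c : 'I_2) J I : (b + c = a + J i)%N ->
  supported i b (set_letter J i c) I -> supported i.+1 a J I.
Proof.
move=> bc /andP[/eqP wK /forallP KI]; apply/andP; split.
  have wJ := weight_set_letter J i c.
  lia.
apply/forallP => s; apply/implyP => ps; have := KI s.
rewrite (ltnW ps) set_letterE; case: (s =P i) => // si.
by rewrite si ltnn in ps.
Qed.

Lemma amplitude_support p a m J I : (p <= n)%N ->
  amplitude p a 0 m J I != 0 -> supported p a J I.
Proof.
move=> pn; apply: contra_neqT; elim: p pn a m J => [|p IHp] pn a m J.
  move=> nsupp; rewrite amplitude0; case: (a =P 0) => [a0|//].
  case: (J =P I) => [JI|_]; last by rewrite andbF.
  case/negP: nsupp; rewrite a0 JI; apply/andP; split; first by rewrite addn0.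
  by apply/forallP => s; rewrite eqxx implybT.
set i := Ordinal pn => nsupp.
have amp0 (b c : 'I_2) m' K : K = set_letter J i c -> (b + c = a + J i)%N ->
    amplitude p b 0 m' K I = 0.
  move=> -> bc; apply: (IHp (ltnW pn)); apply: contra nsupp.
  exact: (@supported_step i).
have amp0J (b : 'I_2) m' : (b = a :> nat) -> amplitude p b 0 m' J I = 0.
  by move=> ba; apply: (amp0 b (J i)); rewrite ?set_letter_id ?ba.
have [a0|a1] := letterP a.
- rewrite a0 (amplitudeS0 i) /= !amp0J ?a0 //; case: ifP => // /eqP/eqP.
  rewrite letter_neq0 => /eqP J1; rewrite (amp0 1 0 m) ?J1 ?a0 //.
  by case: m => [|m]; rewrite ?amp0J ?a0 // !(mulr0, addr0).
- rewrite a1 (amplitudeS1 i) /= amp0J ?a1 //; case: ifP => // /eqP J0.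
  by rewrite (amp0 0 1 m) ?J0 ?a1.
Qed.

Definition ones_before I p := (\sum_(j < n | j < p) I j)%N.

Lemma ones_beforeS I i : ones_before I i.+1 = (ones_before I i + I i)%N.
Proof.
rewrite /ones_before (bigD1 i) //= addnC; congr (_ + _)%N.
by apply: eq_bigl => j; rewrite ltnS ltn_neqAle andbC -val_eqE.
Qed.

(** An empty carrier collects at most one factor [x] per particle crossed, and
    all of them only if it never picks up; once it is loaded, or has been, at
    least one factor is lost. *)
Lemma amplitude_leading p m J I : (p <= n)%N -> (ones_before I p <= m)%N ->
  amplitude p 0 0 m J I = ((m == ones_before I p) && (J == I))%:R
  /\ amplitude p 1 0 m J I = 0.
Proof.
elim: p m J => [|p IHp] m J pn.
  by rewrite /ones_before big_pred0 // !amplitude0.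
set i := Ordinal pn; rewrite (ones_beforeS I i) /= => mN.
have off a m' (K : word n) : K i != I i -> amplitude p a 0 m' K I = 0.
  move=> KI; apply/eqP; apply: contraNT KI => /(amplitude_support (ltnW pn)).
  by case/andP => _ /forallP/(_ i); rewrite leqnn.
have pn' := ltnW pn; rewrite (amplitudeS0 i) (amplitudeS1 i) /=.
have [I0|I1] := letterP (I i).
- move: mN; rewrite I0 addn0 => mN; case: ifP => [/eqP J0|/eqP/eqP].
    by rewrite (off _ _ (set_letter J i 1)) ?set_letter_same ?I0 //; case: (IHp m J).
  rewrite letter_neq0 => /eqP J1.
  have JI : J i != I i by rewrite I0 J1.
  rewrite !(off _ _ J) // (proj2 (IHp m (set_letter J i 0) pn' mN)).
  have -> : (J == I) = false by apply: contraNF JI => /eqP->.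
  by rewrite andbF mulr0 !addr0; case: (m) => [|k]; rewrite ?off.
- move: mN; rewrite I1 addn1 => mN; case: ifP => [/eqP J0|/eqP/eqP].
    have JI : J i != I i by rewrite I1 J0.
    rewrite !(off _ _ J) //.
    have -> : (J == I) = false by apply: contraNF JI => /eqP->.
    rewrite andbF; split=> //.
    by rewrite (proj1 (IHp m (set_letter J i 1) pn' (ltnW mN))) (gtn_eqF mN).
  rewrite letter_neq0 => /eqP J1.
  rewrite (off _ _ (set_letter J i 0)) ?set_letter_same ?I1 // addr0.
  case: m mN => // m mN; rewrite ltnS in mN.
  have [amp_m _] := IHp m J pn' mN; have [ampSm ->] := IHp m.+1 J pn' (leqW mN).
  rewrite amp_m ampSm.
  by rewrite [m.+1 == ones_before I p]gtn_eqF // mulr0 addr0 eqSS.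
Qed.

(** If [J] is full to the right of [h], a carrier that ends loaded has been loaded
    since it left site [h].  It thus has no factor from the sites beyond, nor
    from [h] itself, and to collect all the factors left of [h] it must reach [h]
    empty. *)
Lemma amplitude_pickup (h : 'I_n) I J : I h = 1 ->
  (forall s : 'I_n, (h < s)%N -> J s = 1) ->
  amplitude n 1 0 (ones_before I h) J I = (J == set_letter I h 0)%:R.
Proof.
move=> Ih Jh.
have amp p : (h < p)%N -> (p <= n)%N ->
    amplitude p 1 0 (ones_before I h) J I = (J == set_letter I h 0)%:R.
  elim: p => // p IHp; rewrite ltnS leq_eqVlt => /orP[/eqP <- _|hp pn].
    rewrite amplitudeS1.
    have hn := ltnW (ltn_ord h).
    have [amp0 _] := amplitude_leading (set_letter J h 1) hn (leqnn (ones_before I h)).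
    have [_ amp1] := amplitude_leading J hn (leqnn (ones_before I h)).
    rewrite amp0 amp1 eqxx /=; case: ifP => [/eqP J0|/eqP J0].
      congr (_%:R); apply: (f_equal nat_of_bool); apply/eqP/eqP => [<-|->].
        by rewrite set_letterK set_letter_id.
      by rewrite set_letterK set_letter_id.
    by case: eqP => // JI; case: J0; rewrite JI set_letter_same.
  (* a loaded carrier crosses the particle of J at site p unchanged *)
  rewrite (amplitudeS1 (Ordinal pn)) Jh //=.
  exact: IHp hp (ltnW pn).
exact: amp (ltn_ord h) (leqnn n).
Qed.

End Monodromy.

(** * Creating all words from the full one *)

Section Full.
Variable n : nat.
Implicit Types (J : word n).

Definition full_word : word n := [ffun=> 1].

Lemma weight_leqif J : (weight J <= n ?= iff (J == full_word))%N.
Proof.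
have -> : (J == full_word) = [forall (i | true), J i == 1].
  apply/eqP/forallP => [-> i|J1]; first by rewrite ffunE.
  by apply/ffunP => i; rewrite ffunE; apply/eqP/J1.
rewrite -[X in (_ <= X ?= iff _)%N]card_ord -sum1_card.
apply: leqif_sum => i _; split; first by rewrite -ltnS ltn_ord.
by rewrite -val_eqE.
Qed.

Lemma weight_full J : (weight J == n) = (J == full_word).
Proof. by case: (weight_leqif J). Qed.

End Full.
Arguments full_word {n}.

Section Creation.
Variables (R : comNzRingType) (n : nat).
Local Notation End := (endU R n).
Implicit Types (I J : word n).

Definition coef_of (T : 'M[{poly End}]_2) (X : End) :=
  exists a b m, X = (T a b)`_m.

(** Degree [n] requires a particle passed at every site. *)
Lemma top_coef (y : 'I_n -> R) :
  (monodromy y 0 0)`_n = matrix_unit R full_word full_word.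
Proof.
apply: entry_inj => J I; rewrite entry_matrix_unit -prefix_monodromy_full.
have NI : ones_before I n = weight I by apply: eq_bigl => j; rewrite ltn_ord.
have [wn wnE] := weight_leqif I.
rewrite -/(amplitude y n 0 0 n J I).
have Nn : (ones_before I n <= n)%N by rewrite NI.
rewrite (proj1 (amplitude_leading y J (leqnn n) Nn)) NI [n == _]eq_sym wnE.
case: (I =P full_word) => [->|_]; first by rewrite mulr1.
by rewrite mulr0.
Qed.

(** To create [J], fill its last hole [h] and apply the coefficient of [T_21] that
    digs at [h]; the error terms have as many holes as [J], with a last hole
    further right.  The outer induction is on the number [m] of holes, the inner
    one on the distance [k] from the last hole to the right end. *)
Lemma column_units (y : 'I_n -> R) J :
  subalg_gen (coef_of (monodromy y)) (matrix_unit R J full_word).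
Proof.
have [w wE] := weight_leqif J; have := subnKC w.
move: (n - weight J)%N => m {w wE}.
elim: m J => [|m IHm] J wJ.
  have /eqP-> : J == full_word by rewrite -weight_full; apply/eqP; lia.
  by apply: SubalgGen; exists 0, 0, n; rewrite top_coef.
have hole (K : word n) : (weight K + m.+1 = n)%N -> exists s, K s = 0.
  move=> wK; have nfull : K != full_word.
    by rewrite -weight_full; apply/eqP; lia.
  have /existsP[s /eqP ?] : [exists s, K s == 0]; last by exists s.
  apply: contraNT nfull => /existsPn Kn; apply/eqP/ffunP => s; rewrite ffunE.
  by apply/eqP; rewrite -letter_neq0.
suff IHk k K : (weight K + m.+1 = n)%N ->
    (exists2 s, K s = 0 & (n <= s + k)%N) ->
    subalg_gen (coef_of (monodromy y)) (matrix_unit R K full_word).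
  by have [s Js] := hole J wJ; apply: (IHk n) => //; exists s; rewrite ?leq_addl.
elim: k K => [|k IHk] K wK [s Ks sk].
  by rewrite addn0 leqNgt ltn_ord in sk.
pose P (i : 'I_n) := K i == 0.
have Ps : P s by rewrite /P Ks.
case: (@arg_maxnP _ s P (fun i => val i) Ps) => h /eqP Kh hmax.
pose I := set_letter K h 1; pose X := (monodromy y 1 0)`_(ones_before I h).
have Ih : I h = 1 by rewrite set_letter_same.
have wI : (weight I + m = n)%N.
  by have := weight_set_letter K h 1; rewrite Kh addn0 -/I => ->; rewrite -addnA add1n.
have IK : set_letter I h 0 = K by rewrite set_letterK set_letter_id.
have XI : X * matrix_unit R I full_word =
    matrix_unit R K full_word
    + \sum_(J' | J' != K) entry X J' I *: matrix_unit R J' full_word.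
  rewrite mul_matrix_unit (bigD1 K) //=; congr (_ + _).
  rewrite /X -prefix_monodromy_full -/(amplitude y n 1 0 _ K I).
  rewrite amplitude_pickup // ?IK ?eqxx ?scale1r // => i hi.
  apply/eqP; rewrite -letter_neq0; apply: contraTneq hi => Ki.
  by rewrite -leqNgt; apply: hmax; rewrite /P Ki.
have -> : matrix_unit R K full_word = X * matrix_unit R I full_word
    + (- 1) *: \sum_(J' | J' != K) entry X J' I *: matrix_unit R J' full_word.
  by rewrite XI scaleN1r addrK.
apply: SubalgAdd.
  by apply: SubalgMul; [apply: SubalgGen; exists 1, 0, (ones_before I h) | exact: IHm].
apply: SubalgScale; apply: subalg_gen_sum => J' J'K.
have [->|XJ'] := eqVneq (entry X J' I) 0; first by rewrite scale0r; apply: subalg_gen0.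
have ampJ' : amplitude y n 1 0 (ones_before I h) J' I != 0.
  by rewrite /amplitude prefix_monodromy_full.
apply/SubalgScale/IHk.
  have /andP[/eqP wJ' _] := amplitude_support (leqnn n) ampJ'.
  by move: wI; rewrite -wJ' -addnA add1n.
have /existsP[s' /andP[hs' /eqP ?]] : [exists s' : 'I_n, (h < s')%N && (J' s' == 0)].
  apply: contraNT ampJ' => /existsPn J'h; rewrite amplitude_pickup //.
    by rewrite IK (negbTE J'K).
  by move=> s' hs'; apply/eqP; rewrite -letter_neq0; have := J'h s'; rewrite hs'.
exists s' => //; have sh : (s <= h)%N := hmax s Ps; lia.
Qed.

(** * Transposition and reversal of the sites *)

Definition rev_word J : word n := [ffun i => J (rev_ord i)].

Lemma rev_wordK : involutive rev_word.
Proof. by move=> J; apply/ffunP => i; rewrite !ffunE rev_ordK. Qed.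

Lemma rev_full_word : rev_word full_word = full_word.
Proof. by apply/ffunP => i; rewrite !ffunE. Qed.

(** The transpose, conjugated by the reversal of the tensor factors. *)
Definition flip (X : End) : End :=
  lin_ext (fun I : word n => [ffun J => entry X (rev_word I) (rev_word J)]).

Lemma entry_flip X J I : entry (flip X) J I = entry X (rev_word I) (rev_word J).
Proof. by rewrite /entry lin_ext_fvec ffunE. Qed.

Lemma flip0 : flip 0 = 0.
Proof. by apply: entry_inj => J I; rewrite entry_flip !entry0. Qed.

Lemma flip1 : flip 1 = 1.
Proof.
apply: entry_inj => J I; rewrite entry_flip !entry1.
by rewrite (can_eq rev_wordK) eq_sym.
Qed.

Lemma flipD X Y : flip (X + Y) = flip X + flip Y.
Proof. by apply: entry_inj => J I; rewrite !(entry_flip, entryD). Qed.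

Lemma flipZ (r : R) X : flip (r *: X) = r *: flip X.
Proof. by apply: entry_inj => J I; rewrite !(entry_flip, entryZ). Qed.

Lemma flipM X Y : flip (X * Y) = flip Y * flip X.
Proof.
apply: entry_inj => J I; rewrite entry_flip !entryM.
rewrite (reindex_inj (can_inj rev_wordK)) /=; apply: eq_bigr => K _.
by rewrite !entry_flip mulrC.
Qed.

Lemma flip_sum (A : Type) (s : seq A) (P : pred A) (F : A -> End) :
  flip (\sum_(i <- s | P i) F i) = \sum_(i <- s | P i) flip (F i).
Proof. exact: (big_morph flip flipD flip0). Qed.

Lemma flip_matrix_unit I J :
  flip (matrix_unit R I J) = matrix_unit R (rev_word J) (rev_word I).
Proof.
apply: entry_inj => K L; rewrite entry_flip !entry_matrix_unit mulrC.
by rewrite !(can2_eq rev_wordK rev_wordK).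
Qed.

Lemma entry_site_op1 (i : 'I_n) (M : 'M[R]_2) J I :
  entry (site_op i M) J I = M (J i) (I i) * (set_letter J i (I i) == I)%:R.
Proof.
rewrite -[site_op i M]mulr1 entry_site_op (bigD1 (I i)) //= entry1 big1 ?addr0 // => b bI.
rewrite entry1; case: eqP => [JI|]; last by rewrite mulr0.
by case/eqP: bI; rewrite -JI set_letter_same.
Qed.

Lemma flip_site_op (i : 'I_n) (M : 'M[R]_2) :
  flip (site_op i M) = site_op (rev_ord i) M^T.
Proof.
apply: entry_inj => J I; rewrite entry_flip !entry_site_op1 mxE !ffunE.
congr (_ * (nat_of_bool _)%:R); apply/eqP/eqP => /ffunP JI; apply/ffunP => s.
  have := JI (rev_ord s); rewrite !ffunE rev_ordK (can2_eq rev_ordK rev_ordK).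
  by case: (s =P _) => [->|].
have := JI (rev_ord s); rewrite !ffunE (can_eq rev_ordK).
by case: (s =P i) => [->|_ <-].
Qed.

(** [L] is symmetric under simultaneous transposition of the auxiliary space and
    of the site. *)
Lemma coef_Lax_tr (r : R) a b k : ((Lax r a b)`_k)^T = (Lax r b a)`_k.
Proof.
apply/matrixP => c d; rewrite mxE.
have [/andP[/eqP-> /eqP->]|] := boolP ((a == 0) && (b == 0)).
  by rewrite !entry_Lax00 eq_sym; case: eqP => // ->.
rewrite negb_and => ab; rewrite !entry_Lax_off //; last by rewrite orbC.
by rewrite -!andbA [(d == b) && _]andbC.
Qed.

(** An anti-automorphism applied entrywise reverses a product of matrices after
    their transposition. *)
Lemma flip_prod (L L' : 'I_n -> 'M[{poly End}]_2) (s : seq 'I_n) :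
  (forall i a b m, flip (L i a b)`_m = (L' (rev_ord i) b a)`_m) ->
  forall a b m, flip ((\prod_(i <- s) L i) a b)`_m
    = ((\prod_(i <- rev (map (@rev_ord n) s)) L' i) b a)`_m.
Proof.
move=> LL'; elim: s => [|i s IHs] a b m.
  rewrite !big_nil !mxE !coefMn !coef1 [a == b]eq_sym.
  by case: (b == a); case: (m == 0%N); rewrite ?mulr1n ?mulr0n ?flip0 ?flip1.
rewrite big_cons /= rev_cons -cats1 big_cat big_seq1 !mxE !coef_sum flip_sum.
apply: eq_bigr => c _; rewrite coefM coefMr flip_sum; apply: eq_bigr => k _.
by rewrite flipM LL' IHs.
Qed.

Section Reversal.
Variables y y' : 'I_n -> R.
Hypothesis yy' : forall i, y' (rev_ord i) = y i.

Lemma flip_Lsite i a b m : flip (Lsite y i a b)`_m = (Lsite y' (rev_ord i) b a)`_m.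
Proof. by rewrite !coef_Lsite flip_site_op coef_Lax_tr yy'. Qed.

(** Transposition reverses the order of the sites, and renumbering them restores
    it. *)
Lemma flip_monodromy a b m : flip (monodromy y a b)`_m = (monodromy y' b a)`_m.
Proof.
rewrite (flip_prod _ flip_Lsite) map_rev revK.
suff -> : map (@rev_ord n) (enum 'I_n) = rev (enum 'I_n) by [].
apply: (inj_map val_inj); rewrite -map_comp map_rev val_enum_ord.
apply: (@eq_from_nth _ 0%N) => [|k].
  by rewrite size_map size_rev size_iota size_enum_ord.
rewrite size_map size_enum_ord => kn.
rewrite (nth_map (Ordinal kn)) ?size_enum_ord // nth_rev ?size_iota //.
by rewrite nth_iota /= ?add0n ?nth_enum_ord // ltn_subrL (leq_ltn_trans _ kn).
Qed.

Lemma flip_subalg X : subalg_gen (coef_of (monodromy y)) X ->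
  subalg_gen (coef_of (monodromy y')) (flip X).
Proof.
elim=> [Z [a [b [m ->]]]||Z W _ IHZ _ IHW|c Z _ IHZ|Z W _ IHZ _ IHW].
- by apply: SubalgGen; exists b, a, m; rewrite flip_monodromy.
- by rewrite flip1; apply: SubalgOne.
- by rewrite flipD; apply: SubalgAdd.
- by rewrite flipZ; apply: SubalgScale.
- by rewrite flipM; apply: SubalgMul.
Qed.

End Reversal.

Lemma coef_subalg_full (y : 'I_n -> R) X : subalg_gen (coef_of (monodromy y)) X.
Proof.
apply: (subalg_gen_full (w := full_word)) => [|b]; first exact: column_units.
rewrite -[b]rev_wordK -rev_full_word -flip_matrix_unit.
by apply: (@flip_subalg (y \o @rev_ord n)) => //; apply: column_units.
Qed.

End Creation.

(** * Conjugation by Theta *)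

Section DualSubalgebra.
Variables (R : comNzRingType) (n : nat) (bar : {rmorphism R -> R}).
Hypothesis barK : involutive bar.
Local Notation End := (endU R n).
Implicit Types X Y : End.
Local Notation Tc := (@Theta_conj R n bar).

Lemma Theta_conj_apply X u : Tc X u = Theta bar (X (Theta bar u)).
Proof. by rewrite -{1}[u](ThetaK barK) (Theta_conjE barK). Qed.

Lemma Theta_conjK : involutive Tc.
Proof. by move=> X; apply/lfunP => u; rewrite !Theta_conj_apply !(ThetaK barK). Qed.

Lemma Theta_conj0 : Tc 0 = 0.
Proof.
apply/lfunP => u; rewrite Theta_conj_apply !zero_lfunE.
by apply/ffunP => J; rewrite ThetaE !ffunE rmorph0.
Qed.

Lemma Theta_conj1 : Tc 1 = 1.
Proof. by apply/lfunP => u; rewrite Theta_conj_apply !id_lfunE (ThetaK barK). Qed.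

Lemma Theta_conjD X Y : Tc (X + Y) = Tc X + Tc Y.
Proof.
apply/lfunP => u; rewrite add_lfunE !Theta_conj_apply add_lfunE.
by rewrite -[X in Theta _ (X + _)]scale1r Theta_semilinear rmorph1 scale1r.
Qed.

Lemma Theta_conjZ (c : R) X : Tc (c *: X) = bar c *: Tc X.
Proof.
apply/lfunP => u; rewrite scale_lfunE !Theta_conj_apply scale_lfunE.
by apply/ffunP => J; rewrite ffunE !ThetaE ffunE rmorphM.
Qed.

Lemma Theta_conjM X Y : Tc (X * Y) = Tc X * Tc Y.
Proof.
by apply/lfunP => u; rewrite endU_mulE !Theta_conj_apply endU_mulE (ThetaK barK).
Qed.

Lemma Theta_conj_subalg (M : 'M[{poly End}]_2) X : subalg_gen (coef_of M) X ->
  subalg_gen (coef_of (map_mx (map_poly Tc) M)^T) (Tc X).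
Proof.
elim=> [Z [a [b [m ->]]]||Z W _ IHZ _ IHW|c Z _ IHZ|Z W _ IHZ _ IHW].
- apply: SubalgGen; exists b, a, m.
  by rewrite !mxE coef_map_id0 ?Theta_conj0.
- by rewrite Theta_conj1; apply: SubalgOne.
- by rewrite Theta_conjD; apply: SubalgAdd.
- by rewrite Theta_conjZ; apply: SubalgScale.
- by rewrite Theta_conjM; apply: SubalgMul.
Qed.

Lemma dual_coef_subalg_full (y : 'I_n -> R) X :
  subalg_gen (coef_of (map_mx (map_poly Tc) (monodromy y))^T) X.
Proof.
rewrite -[X]Theta_conjK; apply: Theta_conj_subalg; exact: coef_subalg_full.
Qed.

End DualSubalgebra.

Lemma coef_subalg_yang_baxter (R : comNzRingType) (n : nat)
    (M : 'M[{poly endU R n}]_2) X :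
  subalg_gen (coef_of M) X -> yang_baxter M X.
Proof.
elim=> [Z [a [b [m ->]]]||Z W _ IHZ _ IHW|c Z _ IHZ|Z W _ IHZ _ IHW].
- by apply: SubalgGen; apply: YBCoef.
- exact: SubalgOne.
- exact: SubalgAdd.
- exact: SubalgScale.
- exact: SubalgMul.
Qed.

(** * The fermionic operators *)

Section Fermions.
Variables (R : comNzRingType) (n : nat).
Local Notation End := (endU R n).
Implicit Types (I J : word n) (i j : 'I_n).

Lemma wedge_uniq (s : seq 'I_n) : uniq s ->
  exists e, wedge R s = (-1) ^+ e *: fvec R [set i in s].
Proof. by rewrite /wedge => ->; exists (inversions s). Qed.

Lemma ext_to_tens_fvec (A : {set 'I_n}) :
  ext_to_tens R n (fvec R A) = fvec R [ffun i => if i \in A then 1 else 0 : 'I_2].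
Proof. exact: lin_ext_fvec. Qed.

Lemma set_of_word I j (b : 'I_2) (A : {set 'I_n}) :
  (forall i, (i \in A) = (set_letter I j b i == 1)) ->
  [ffun i => if i \in A then 1 else 0 : 'I_2] = set_letter I j b.
Proof.
move=> AE; apply/ffunP => i; rewrite ffunE AE.
by case: (set_letter I j b i) => -[|[|?]] //= ?; apply: val_inj.
Qed.

Lemma gamma_star_word j I : exists e, gamma_star R j (fvec R I) =
  if I j == 0 then (-1) ^+ e *: fvec R (set_letter I j 1) else 0.
Proof.
rewrite /gamma_star !comp_lfunE /tens_to_ext lin_ext_fvec /psi_star lin_ext_fvec.
set A := [set i | I i == 1]; have AE i : (i \in A) = (I i == 1) by rewrite inE.
have [Ij|Ij] := eqVneq (I j) 0.
  have us : uniq (j :: enum A) by rewrite /= mem_enum AE Ij enum_uniq.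
  have [e ->] := wedge_uniq us; exists e.
  rewrite linearZ /= ext_to_tens_fvec (@set_of_word I j 1) // => i.
  rewrite inE in_cons mem_enum AE set_letterE; by case: (i =P j).
exists 0%N; rewrite /wedge /= mem_enum AE.
by rewrite -letter_neq0 Ij linear0.
Qed.

Lemma gamma_word j I : exists e, gamma R j (fvec R I) =
  if I j == 1 then (-1) ^+ e *: fvec R (set_letter I j 0) else 0.
Proof.
rewrite /gamma !comp_lfunE /tens_to_ext lin_ext_fvec /psi lin_ext_fvec.
set A := [set i | I i == 1]; have AE i : (i \in A) = (I i == 1) by rewrite inE.
set s := enum A; have us : uniq s by apply: enum_uniq.
case: (boolP (I j == 1)) => [Ij|/negbTE Ij]; last first.
  exists 0%N; rewrite big1 ?linear0 // => r _.
  case: eqP => [jr|_]; last by rewrite mulr0 scale0r.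
  by have := mem_nth j (ltn_ord r); rewrite jr mem_enum AE Ij.
have js : j \in s by rewrite mem_enum AE.
have rs : (index j s < size s)%N by rewrite index_mem.
rewrite (bigD1 (Ordinal rs)) //= big1 => [|r rj]; last first.
  case: eqP => [jr|_]; last by rewrite mulr0 scale0r.
  by case/eqP: rj; apply: val_inj; rewrite /= -[in RHS]jr index_uniq.
rewrite nth_index // eqxx mulr1 addr0 -remE.
have [e ->] := wedge_uniq (rem_uniq j us); exists (index j s + e)%N.
rewrite scalerA -exprD linearZ /= ext_to_tens_fvec (@set_of_word I j 0) // => i.
rewrite inE (mem_rem_uniq _ us) inE mem_enum AE set_letterE.
by case: (i =P j).
Qed.

Definition empty_word : word n := [ffun=> 0].

Local Notation S := (subalg_gen (@fermion R n)).

(** The signs of the fermionic operators can be ignored when generating. *)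
Lemma signed_unit (e : nat) (I J : word n) :
  S ((-1) ^+ e *: matrix_unit R I J) -> S (matrix_unit R I J).
Proof.
move=> /(SubalgScale ((-1) ^+ e)); rewrite scalerA -exprD addnn -muln2 mulnC.
by rewrite exprM sqrrN !expr1n scale1r.
Qed.

(** Up to a sign on each basis vector, the projection onto the words with a hole
    at [j]. *)
Definition vacancy j : End := gamma R j * gamma_star R j.

Lemma vacancies_word (s : seq 'I_n) I : exists e,
  (\prod_(j <- s) vacancy j) (fvec R I) =
  if all (fun j => I j == 0) s then (-1) ^+ e *: fvec R I else 0.
Proof.
elim: s => [|j s [e IHs]]; first by exists 0%N; rewrite big_nil id_lfunE scale1r.
have [e1 E1] := gamma_star_word j I.
have [e2 E2] := gamma_word j (set_letter I j 1).
exists (e + (e1 + e2))%N; rewrite big_cons endU_mulE IHs /=.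
case: ifP => _; last by rewrite andbF linear0.
rewrite andbT linearZ /= endU_mulE E1; case: eqP => [Ij|_]; last by rewrite !linear0.
rewrite linearZ /= E2 set_letter_same eqxx set_letterK set_letter_id //.
by rewrite !scalerA !exprD mulrA.
Qed.

Lemma vacuum_unit : S (matrix_unit R empty_word empty_word).
Proof.
have [e vac] := vacancies_word (enum 'I_n) empty_word.
apply: (@signed_unit e).
have <- : \prod_(j <- enum 'I_n) vacancy j
    = (-1) ^+ e *: matrix_unit R empty_word empty_word.
  apply: entry_inj => J I; rewrite entryZ entry_matrix_unit.
  case: (I =P empty_word) => [->|nI].
    rewrite /entry vac (introT allP) => [|j _]; last by rewrite ffunE.
    by rewrite !ffunE mulr1.
  have [e' E] := vacancies_word (enum 'I_n) I; rewrite /entry E.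
  case: allP => [I0|_]; last by rewrite ffunE !mulr0.
  by case: nI; apply/ffunP => i; rewrite ffunE; apply/eqP/I0; rewrite mem_enum.
apply: big_ind => [|X Y|j _]; [exact: SubalgOne | exact: SubalgMul |].
by apply: SubalgMul; apply: SubalgGen; constructor.
Qed.

Lemma empty_word_ind (P : word n -> Prop) : P empty_word ->
  (forall J j, J j = 0 -> P J -> P (set_letter J j 1)) -> forall J, P J.
Proof.
move=> P0 PS J; move: {2}(weight J) (erefl (weight J)) => m.
elim: m J => [|m IHm] J wJ.
  have -> // : J = empty_word.
  apply/ffunP => i; rewrite ffunE; apply: val_inj => /=.
  by move: wJ; rewrite /weight (bigD1 i) //=; case: (J i : nat).
have /existsP[j /eqP Jj] : [exists j, J j == 1].
  apply: contra_eqT wJ => /existsPn J0; rewrite /weight big1 // => i _.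
  by have := J0 i; rewrite -letter_neq0 negbK => /eqP->.
rewrite -(set_letter_id Jj) -(set_letterK J j 0 1); apply: PS.
  by rewrite set_letter_same.
apply: IHm; have := weight_set_letter J j 0; rewrite Jj wJ addn0 addn1.
by case.
Qed.

Lemma fermion_subalg_full X : S X.
Proof.
apply: (subalg_gen_full (w := empty_word)).
  apply: empty_word_ind => [|J j Jj SJ]; first exact: vacuum_unit.
  have [e] := gamma_star_word j J; rewrite Jj eqxx => /mul_unit_col E.
  apply: (@signed_unit e); rewrite -E.
  by apply: SubalgMul => //; apply: SubalgGen; constructor.
apply: empty_word_ind => [|J j Jj SJ]; first exact: vacuum_unit.
have [e Ee] := gamma_word j (set_letter J j 1).
apply: (@signed_unit e).
rewrite set_letter_same eqxx set_letterK (set_letter_id Jj) in Ee.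
have <- : matrix_unit R empty_word J * gamma R j
    = (-1) ^+ e *: matrix_unit R empty_word (set_letter J j 1).
  rewrite mul_matrix_unitr (bigD1 (set_letter J j 1)) //= big1 => [|K KJ].
    by rewrite addr0 /entry Ee !ffunE eqxx [_ *: true%:R]mulr1.
  have [e' E'] := gamma_word j K; rewrite /entry E'.
  case: eqP => [Kj|_]; last by rewrite ffunE scale0r.
  rewrite !ffunE; case: eqP => [JK|_]; last by rewrite [_ *: false%:R]mulr0 scale0r.
  by case/eqP: KJ; rewrite JK set_letterK set_letter_id.
by apply: SubalgMul => //; apply: SubalgGen; constructor.
Qed.

End Fermions.

Theorem theoremC2 (n : nat) (n_ge2 : (1 < n)%N) :
  [/\ forall X : endU (baseR n) n, YBalg X <-> fermion_alg X,
      forall X : endU (baseR n) n, dualYBalg X <-> fermion_alg X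
    & forall X : endU (baseR n) n, YBalg X <-> dualYBalg X].
Proof.
have F (X : endU (baseR n) n) : fermion_alg X := fermion_subalg_full X.
have Y (X : endU (baseR n) n) : YBalg X :=
  coef_subalg_yang_baxter (coef_subalg_full (@yvar n) X).
have Y' (X : endU (baseR n) n) : dualYBalg X.
  exact: coef_subalg_yang_baxter (dual_coef_subalg_full (@barK n) (@yvar n) X).
by split.
Qed.
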